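(* All surfaces of revolution in three-dimensional Euclidean space admit a pure bending eversion; that is, for every surface of revolution $\mathscr{S}$ there exists an isometric deformation $\bm{y}$ of $\mathscr{S}$ that is of pure bending and is an eversion.
   Context: Surfaces are smooth and oriented, with unit normal $\bm{\nu}$. Surface gradient: for a differentiable field $f$ on a surface $\mathscr{S}$, $\nabla_{\mathrm s}f$ annihilates $\bm{\nu}$ and satisfies $\frac{d}{dt}f(\bm{x}(t))=(\nabla_{\mathrm s}f)\dot{\bm{x}}$ along every smooth curve $\bm{x}(t)$ on $\mathscr{S}$. The curvature tensor is $\nabla_{\mathrm s}\bm{\nu}$. $\mathbf{P}(\bm{\nu})=\mathbf{I}-\bm{\nu}\otimes\bm{\nu}$. Deformation: a twice continuously differentiable map $\bm{y}$ of $\mathscr{S}$ onto a surface $\mathscr{S}^\ast=\bm{y}(\mathscr{S})$ with polar decomposition $\nabla_{\mathrm s}\bm{y}=\mathbf{R}\mathbf{U}$, where $\mathbf{U}(\bm{x})$ is symmetric and positive definite on the tangent plane to $\mathscr{S}$ at $\bm{x}$ ($\mathbf{U}\bm{\nu}=\bm{0}$) and $\mathbf{R}(\bm{x})\in\mathsf{SO}(3)$ is the polar rotation; $\mathscr{S}^\ast$ is oriented by $\bm{\nu}^\ast(\bm{y}(\bm{x}))=\mathbf{R}(\bm{x})\bm{\nu}(\bm{x})$, and $\nabla^\ast_{\mathrm s}$ denotes the surface gradient on $\mathscr{S}^\ast$. A deformation is isometric if it preserves both angles and area; equivalently $\nabla_{\mathrm s}\bm{y}=\mathbf{R}\mathbf{P}(\bm{\nu})$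 with $\mathbf{R}(\bm{x})\in\mathsf{SO}(3)$. Every polar rotation is decomposed as $\mathbf{R}=\mathbf{R}_{\mathrm b}\mathbf{R}_{\mathrm d}$ with $\mathbf{R}_{\mathrm d}$ a rotation about $\bm{\nu}$ (drilling) and $\mathbf{R}_{\mathrm b}$ a rotation about an axis orthogonal to $\bm{\nu}$ (bending). A deformation is of pure bending (in a given frame) if $\mathbf{R}_{\mathrm d}=\mathbf{I}$, i.e. if for every $\bm{x}$ the rotation $\mathbf{R}(\bm{x})$ is about an axis orthogonal to $\bm{\nu}(\bm{x})$. An isometric deformation $\bm{y}$ is an eversion if $(\nabla^\ast_{\mathrm s}\bm{\nu}^\ast)(\bm{y}(\bm{x}))=-\mathbf{R}(\bm{x})\,\nabla_{\mathrm s}\bm{\nu}(\bm{x})\,\mathbf{R}(\bm{x})^{\mathsf T}$ for all $\bm{x}\in\mathscr{S}$. *)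

(* Defs.v *)
From mathcomp Require Export all_boot all_order all_algebra.
From mathcomp Require Export all_classical all_reals all_analysis.
From mathcomp Require Import ring lra.

Set Implicit Arguments.
Unset Strict Implicit.
Unset Printing Implicit Defensive.

Import Order.TTheory GRing.Theory Num.Theory.
Import numFieldNormedType.Exports.

Local Open Scope classical_set_scope.
Local Open Scope ring_scope.

(* Points and vectors of Euclidean 3-space are column vectors, second-order
   tensors are 3 x 3 matrices acting on the left, a (x) b is a *m b^T. *)

Section Euclidean.
Variable R : realType.
Local Notation E := 'cV[R]_3.
Local Notation tensor := 'M[R]_3.
Implicit Types (u v n : E) (Q : tensor).

Definition dot u v : R := (u^T *m v) 0 0.

Definition enorm u : R := Num.sqrt (dot u u).

Definition SO3 Q : Prop := Q^T *m Q = 1%:M /\ \det Q = 1.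

Definition rotation_about v Q : Prop := [/\ dot v v = 1, SO3 Q & Q *m v = v].

Definition proj n : tensor := 1%:M - n *m n^T.

(* The angle in [0, pi] is determined by its cosine. *)
Definition cos_angle u v : R := dot u v / (enorm u * enorm v).

(* |u x v|, by Lagrange's identity. *)
Definition parallelogram_area u v : R :=
  Num.sqrt (dot u u * dot v v - dot u v ^+ 2).

(* Here n is the unit normal and G the surface gradient of a deformation at
   one point. *)
Definition preserves_angles n (G : tensor) : Prop :=
  forall u v, dot u n = 0 -> dot v n = 0 -> u != 0 -> v != 0 ->
    cos_angle (G *m u) (G *m v) = cos_angle u v.

Definition preserves_area n (G : tensor) : Prop :=
  forall u v, dot u n = 0 -> dot v n = 0 ->
    parallelogram_area (G *m u) (G *m v) = parallelogram_area u v.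

Definition polar_decomposition n (G Q U : tensor) : Prop :=
  [/\ G = Q *m U, SO3 Q, U^T = U, U *m n = 0
    & forall u, dot u n = 0 -> u != 0 -> 0 < dot u (U *m u)].

(* Q = Qb Qd with Qd the drilling part and Qb the bending part. *)
Definition bending_drilling n Q Qb Qd : Prop :=
  [/\ Q = Qb *m Qd, rotation_about n Qd
    & exists e : E, dot e n = 0 /\ rotation_about e Qb].

Let dotDl u v w : dot (u + v) w = dot u w + dot v w.
Proof. by rewrite /dot linearD /= mulmxDl mxE. Qed.
Let dotC u v : dot u v = dot v u.
Proof. by rewrite /dot -[in RHS](trmxK u) -trmx_mul [in RHS]mxE. Qed.
Let dotZl a u v : dot (a *: u) v = a * dot u v.
Proof. by rewrite /dot linearZ /= -scalemxAl mxE. Qed.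
Let dotDr u v w : dot w (u + v) = dot w u + dot w v.
Proof. by rewrite dotC dotDl ![dot _ w]dotC. Qed.
Let dotZr a u v : dot v (a *: u) = a * dot v u.
Proof. by rewrite dotC dotZl [dot _ v]dotC. Qed.
Let dotBl u v w : dot (u - v) w = dot u w - dot v w.
Proof. by rewrite -scaleN1r dotDl dotZl mulN1r. Qed.
Let dotBr u v w : dot w (u - v) = dot w u - dot w v.
Proof. by rewrite -scaleN1r dotDr dotZr mulN1r. Qed.
Let dotE u v : dot u v = \sum_(i < 3) u i 0 * v i 0.
Proof. by rewrite /dot mxE; apply: eq_bigr => i _; rewrite mxE. Qed.
Let dot_ge0 u : 0 <= dot u u.
Proof. by rewrite dotE sumr_ge0 // => i _; rewrite -expr2 sqr_ge0. Qed.
Let dot_eq0 u : dot u u = 0 -> u = 0.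
Proof.
rewrite dotE => /eqP; rewrite psumr_eq0; last by move=> i _; rewrite -expr2 sqr_ge0.
move/allP => h; apply/colP => i; rewrite mxE.
by have := h i (mem_index_enum _); rewrite mulf_eq0 orbb => /eqP.
Qed.
Let dot_mx (A : tensor) u v : dot (A *m u) v = dot u (A^T *m v).
Proof. by rewrite /dot trmx_mul mulmxA. Qed.
Let dot_orth Q u v : Q^T *m Q = 1%:M -> dot (Q *m u) (Q *m v) = dot u v.
Proof. by move=> h; rewrite dot_mx mulmxA h mul1mx. Qed.

Let projE n u : proj n *m u = u - dot n u *: n.
Proof.
rewrite /proj mulmxBl mul1mx -mulmxA; congr (_ - _).
by rewrite (mx11_scalar (n^T *m u)) mul_mx_scalar.
Qed.

Let turn n u : dot n n = 1 -> dot u n = 0 ->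
  exists v, [/\ dot v n = 0, dot u v = 0 & dot v v = dot u u].
Proof.
pose i0 : 'I_3 := 0; pose i1 : 'I_3 := 1; pose i2 : 'I_3 := 1 + 1.
have E3 (a b : E) : dot a b = a i0 0 * b i0 0 + a i1 0 * b i1 0 + a i2 0 * b i2 0.
  rewrite dotE !big_ord_recl big_ord0 addr0 addrA.
  by do 2?congr (_ + _); congr (a _ _ * b _ _); apply: val_inj.
move=> hn hu.
pose v : E := \col_i (if i == i0 then n i1 0 * u i2 0 - n i2 0 * u i1 0 else
   if i == i1 then n i2 0 * u i0 0 - n i0 0 * u i2 0
   else n i0 0 * u i1 0 - n i1 0 * u i0 0).
have v0 : v i0 0 = n i1 0 * u i2 0 - n i2 0 * u i1 0 by rewrite mxE.
have v1 : v i1 0 = n i2 0 * u i0 0 - n i0 0 * u i2 0 by rewrite mxE.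
have v2 : v i2 0 = n i0 0 * u i1 0 - n i1 0 * u i0 0 by rewrite mxE.
exists v; split; rewrite ?E3 ?v0 ?v1 ?v2; try ring.
transitivity (dot n n * dot u u - dot u n ^+ 2); last first.
  by rewrite hn hu expr0n /= subr0 mul1r E3.
by rewrite !E3; ring.
Qed.

(* An isometric deformation is one whose surface gradient is Q P(n). *)
Lemma isometric_polarP n G Q U :
  dot n n = 1 -> polar_decomposition n G Q U ->
  preserves_angles n G /\ preserves_area n G <-> U = proj n.
Proof.
move=> hn [-> [hQ _] hU hUn hpos].
have GG u v : dot (Q *m U *m u) (Q *m U *m v) = dot (U *m u) (U *m v).
  by rewrite -!mulmxA dot_orth.
split=> [[ang area]|->]; last first.
  have GE u v : dot u n = 0 -> dot v n = 0 ->
      dot (Q *m proj n *m u) (Q *m proj n *m v) = dot u v.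
    move=> hu hv; rewrite -!mulmxA dot_orth // !projE.
    by rewrite !(dotC n) hu hv !scale0r !subr0.
  split=> u v hu hv; rewrite /cos_angle /enorm /parallelogram_area.
    by move=> _ _; rewrite !GE.
  by rewrite !GE.
have tangU u : dot (U *m u) n = 0 by rewrite dot_mx hU hUn /dot mulmx0 mxE.
have Upos u : dot u n = 0 -> u != 0 -> 0 < dot (U *m u) (U *m u).
  move=> hu u0; rewrite lt_neqAle dot_ge0 andbT eq_sym.
  apply/eqP => /dot_eq0 h; have := hpos _ hu u0.
  by rewrite h /dot mulmx0 mxE ltxx.
have orth u v : dot u n = 0 -> dot v n = 0 -> dot u v = 0 ->
    dot (U *m u) (U *m v) = 0.
  move=> hu hv huv; have [->|u0] := eqVneq u 0.
    by rewrite mulmx0 /dot trmx0 mul0mx mxE.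
  have [->|v0] := eqVneq v 0; first by rewrite mulmx0 /dot mulmx0 mxE.
  have := ang _ _ hu hv u0 v0; rewrite /cos_angle /enorm !GG huv mul0r => /eqP.
  rewrite mulf_eq0 invr_eq0 mulf_eq0 !sqrtr_eq0 !leNgt !Upos //= orbF.
  by move/eqP.
have norm u : dot u n = 0 -> dot (U *m u) (U *m u) = dot u u.
  move=> hu; have [v [hv huv hvv]] := turn hn hu.
  have Guv := orth _ _ hu hv huv.
  have : dot (U *m (u + v)) (U *m (u - v)) = 0.
    apply: orth.
    - by rewrite dotDl hu hv addr0.
    - by rewrite dotBl hu hv subr0.
    by rewrite dotDl !dotBr (dotC v u) huv hvv; ring.
  rewrite mulmxDr mulmxBr dotDl !dotBr (dotC (U *m v) (U *m u)) Guv => e.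
  have {}e : dot (U *m v) (U *m v) = dot (U *m u) (U *m u) by lra.
  have := area _ _ hu hv; rewrite /parallelogram_area !GG Guv huv e hvv.
  rewrite expr0n /= !subr0 -!expr2 !sqrtr_sqr !ger0_norm //; exact: dot_ge0.
have polar u v : dot u n = 0 -> dot v n = 0 ->
    dot (U *m u) (U *m v) = dot u v.
  move=> hu hv; have : dot (u + v) n = 0 by rewrite dotDl hu hv addr0.
  move/norm; rewrite mulmxDr !dotDl !dotDr !norm // (dotC (U *m v)) (dotC v u).
  lra.
have Uid u : dot u n = 0 -> U *m u = u.
  move=> hu; apply/eqP; rewrite -subr_eq0.
  set w := U *m u - u; apply/negPn/negP => w0.
  have hw : dot w n = 0 by rewrite dotBl tangU hu subr0.
  suff : dot w (U *m w) + dot w w = 0.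
    by have := hpos _ hw w0; have := dot_ge0 w; lra.
  have -> : dot w (U *m w) = dot w u - dot w (U *m u).
    by rewrite mulmxBr dotBr -(polar w u) // dot_mx hU.
  by rewrite [in X in _ + X]/w dotBr; ring.
apply/matrixP => i j.
have <- : (U *m delta_mx j (0 : 'I_1)) i 0 = U i j.
  by rewrite -colE mxE.
have <- : (proj n *m delta_mx j (0 : 'I_1)) i 0 = proj n i j.
  by rewrite -colE mxE.
congr (fun_of_matrix _ i 0); set d : E := delta_mx j 0.
rewrite -[in LHS](subrK (dot n d *: n) d) mulmxDr -scalemxAr hUn scaler0 addr0.
rewrite projE Uid // dotBl dotZl hn mulr1 dotC subrr //.
Qed.

End Euclidean.

Section Smoothness.
Variable R : realType.

(* Ck k f A: f is of class C^k on the open set A (V is finite-dimensional in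
   all uses). *)
Fixpoint Ck (V W : normedModType R) (k : nat) (f : V -> W) (A : set V) : Prop :=
  if k is k'.+1 then
    (forall x, A x -> differentiable f x) /\ (forall v : V, Ck k' ('D_v f) A)
  else forall x, A x -> {for x, continuous f}.

Definition smooth (V W : normedModType R) (f : V -> W) (A : set V) : Prop :=
  forall k, Ck k f A.

(* Class C^k on an arbitrary subset S: f extends locally to a C^k map of the
   ambient space. *)
Definition Ck_on (V W : normedModType R) (k : nat) (f : V -> W) (S : set V) :
    Prop :=
  forall x, S x -> exists (A : set V) (F : V -> W),
    [/\ open A, A x, Ck k F A & forall z, A z -> S z -> F z = f z].

End Smoothness.

Section Surfaces.
Variable R : realType.
Local Notation E := 'cV[R]_3.
Local Notation tensor := 'M[R]_3.
Implicit Types (S : set E) (nu y : E -> E) (Rot U : E -> tensor).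

(* S is an embedded 2-dimensional submanifold: near each of its points it is
   the diffeomorphic image of an open set B of the plane, the inverse chart psi
   being defined on an open set A of space. *)
Definition smooth_surface S : Prop :=
  forall x, S x -> exists (A : set E) (B : set 'cV[R]_2)
      (phi : 'cV[R]_2 -> E) (psi : E -> 'cV[R]_2),
    [/\ open A /\ A x, open B, smooth phi B, smooth psi A
      & phi @` B = A `&` S /\ forall p, B p -> psi (phi p) = p].

Definition smooth_curve_on S (a b : R) (c : R -> E) : Prop :=
  smooth c (`]a, b[) /\ forall t, a < t < b -> S (c t).

Definition oriented_surface S nu : Prop :=
  [/\ smooth_surface S,
      forall k, Ck_on k nu S,
      forall x, S x -> dot (nu x) (nu x) = 1
    & forall a b c, smooth_curve_on S a b c ->
        forall t, a < t < b -> dot (nu (c t)) (derive1 c t) = 0].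

(* G is the value at x of the surface gradient of f on S; G is unique, since
   the velocities of curves on S through x span the tangent plane. *)
Definition is_surface_gradient S nu (f : E -> E) (x : E) (G : tensor) : Prop :=
  G *m nu x = 0 /\
  forall a b c, smooth_curve_on S a b c ->
    forall t, a < t < b -> c t = x ->
      is_derive t 1 (f \o c) (G *m derive1 c t).

(* y maps the surface S, oriented by nu, onto the surface y @` S, oriented by
   nus; Rot and U are the factors of the polar decomposition of its surface
   gradient. *)
Definition deformation S nu y Rot U nus : Prop :=
  [/\ Ck_on 2 y S,
      forall x, S x -> exists2 G, is_surface_gradient S nu y x G &
        polar_decomposition (nu x) G (Rot x) (U x),
      oriented_surface (y @` S) nus
    & forall x, S x -> nus (y x) = Rot x *m nu x].

Definition isometric S nu y : Prop :=
  forall x, S x -> exists2 G, is_surface_gradient S nu y x G &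
    preserves_angles (nu x) G /\ preserves_area (nu x) G.

Definition pure_bending S nu Rot : Prop :=
  forall x, S x -> exists Rb, bending_drilling (nu x) (Rot x) Rb 1%:M.

(* H is the curvature tensor of S at x, Hs that of y @` S at y x. *)
Definition eversion S nu y Rot nus : Prop :=
  forall x, S x -> exists H Hs,
    [/\ is_surface_gradient S nu nu x H,
        is_surface_gradient (y @` S) nus nus (y x) Hs
      & Hs = - (Rot x *m H *m (Rot x)^T)].

(* S is swept out by a curve t |-> o + r t b + z t a, t in an interval J, of a
   plane through the axis (o, a), under all rotations about that axis. The
   curve may meet the axis, as for a sphere or a plane. *)
Definition surface_of_revolution S : Prop :=
  exists (o a b : E) (J : set R) (r z : R -> R),
    [/\ [/\ dot a a = 1, dot b b = 1 & dot a b = 0],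
        is_interval J, {within J, continuous r}, {within J, continuous z}
      & S = [set x | exists t Q, [/\ J t, rotation_about a Q
              & x = o + Q *m (r t *: b + z t *: a)]]].

End Surfaces.

(* Main.v *)
Require Import Defs.
From mathcomp Require Import ring lra.
Import Order.TTheory GRing.Theory Num.Theory.
Import numFieldNormedType.Exports.
Local Open Scope classical_set_scope.
Local Open Scope ring_scope.

Set Implicit Arguments.
Unset Strict Implicit.
Unset Printing Implicit Defensive.

(* Let a be a unit vector along the axis and let y be the reflection M_a in the
   plane orthogonal to a. Its surface gradient is M_a P(nu). As M_a reverses
   orientation, the polar rotation is not M_a but M_a M_nu, with M_nu the
   reflection in the tangent plane; the product of two reflections is a rotation
   about an axis orthogonal to both a and nu, hence a bending. The image is
   oriented by M_a M_nu nu = - M_a nu, so its curvature tensor is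
   - M_a H M_a^T = - (M_a M_nu) H (M_a M_nu)^T, as H nu = 0 and nu^T H = 0. *)

(** * Linear algebra of projections and reflections *)

Section Algebra.
Variable R : realType.
Local Notation E := 'cV[R]_3.
Implicit Types (a n u v w : E) (Q : 'M[R]_3).

Lemma dotE u v : dot u v = \sum_(i < 3) u i 0 * v i 0.
Proof. by rewrite /dot mxE; apply: eq_bigr => i _; rewrite mxE. Qed.

Lemma dotC u v : dot u v = dot v u.
Proof. by rewrite !dotE; apply: eq_bigr => i _; rewrite mulrC. Qed.

Lemma dotZr (k : R) u v : dot v (k *: u) = k * dot v u.
Proof. by rewrite /dot -scalemxAr mxE. Qed.

Lemma dotNr u v : dot v (- u) = - dot v u.
Proof. by rewrite -scaleN1r dotZr mulN1r. Qed.

Lemma dotNN u v : dot (- u) (- v) = dot u v.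
Proof. by rewrite dotNr dotC dotNr opprK dotC. Qed.

Lemma dot_gt0 u : u != 0 -> 0 < dot u u.
Proof.
move=> u0; have sq_ge0 i : true -> 0 <= u i 0 * u i 0.
  by rewrite -expr2 sqr_ge0.
rewrite dotE lt_neqAle sumr_ge0 // andbT eq_sym; apply: contra u0.
rewrite psumr_eq0 // => /allP h; apply/eqP/colP => i; rewrite mxE.
by have := h i (mem_index_enum _); rewrite mulf_eq0 orbb => /eqP.
Qed.

Lemma dot_mulmx Q u v : dot u (Q *m v) = dot (Q^T *m u) v.
Proof. by rewrite /dot trmx_mul trmxK mulmxA. Qed.

Lemma dot_orthogonal Q u v : Q^T *m Q = 1%:M -> dot (Q *m u) (Q *m v) = dot u v.
Proof. by move=> hQ; rewrite dot_mulmx mulmxA hQ mul1mx. Qed.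

Lemma mulmx_outer u v w : u *m v^T *m w = dot v w *: u.
Proof. by rewrite -mulmxA (mx11_scalar (v^T *m w)) mul_mx_scalar. Qed.

Lemma trmx_proj n : (proj n)^T = proj n.
Proof. by rewrite linearB /= trmx1 trmx_mul trmxK. Qed.

Lemma proj_mulmx n u : proj n *m u = u - dot n u *: n.
Proof. by rewrite mulmxBl mul1mx mulmx_outer. Qed.

Lemma proj_normal n : dot n n = 1 -> proj n *m n = 0.
Proof. by move=> hn; rewrite proj_mulmx hn scale1r subrr. Qed.

Lemma proj_tangent n u : dot n u = 0 -> proj n *m u = u.
Proof. by move=> nu; rewrite proj_mulmx nu scale0r subr0. Qed.

(** For unit [a], the Householder reflection in the plane orthogonal to [a]. The factor 2 sits in
    the column: up to a sign, the tensor is then the identity plus a column times a row, as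
    [det_add1_mulmx] expects. *)
Definition reflection a : 'M[R]_3 := 1%:M - (2 *: a) *m a^T.

Lemma reflection_mulmx a u : reflection a *m u = u - (2 * dot a u) *: a.
Proof. by rewrite mulmxBl mul1mx mulmx_outer scalerA mulrC. Qed.

Lemma reflection_fix a u : dot a u = 0 -> reflection a *m u = u.
Proof. by move=> au; rewrite reflection_mulmx au mulr0 scale0r subr0. Qed.

Lemma reflection_normal a : dot a a = 1 -> reflection a *m a = - a.
Proof.
by move=> ha; rewrite reflection_mulmx ha mulr1 scaler_nat mulr2n opprD
  addrA subrr add0r.
Qed.

Lemma trmx_reflection a : (reflection a)^T = reflection a.
Proof.
by rewrite linearB /= trmx1 trmx_mul trmxK linearZ /= -scalemxAr scalemxAl.
Qed.

Lemma reflection_invol a :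
  dot a a = 1 -> reflection a *m reflection a = 1%:M.
Proof.
move=> ha; rewrite {2}/reflection mulmxBr mulmx1 mulmxA -scalemxAr.
by rewrite reflection_normal // scalerN mulNmx opprK subrK.
Qed.

Lemma reflection_proj n : dot n n = 1 -> reflection n *m proj n = proj n.
Proof.
move=> hn; rewrite mulmxBl mul1mx -mulmxA.
by rewrite -(trmx_proj n) -trmx_mul proj_normal // trmx0 mulmx0 subr0.
Qed.

(** Sylvester's identity: one block matrix factors in two ways into block triangular ones, whose
    only diagonal block other than the identity is [1%:M + A *m B] or [1%:M + B *m A]. *)
Lemma det_add1_mulmx (T : comNzRingType) m p (A : 'M[T]_(m, p))
    (B : 'M[T]_(p, m)) :
  \det (1%:M + A *m B) = \det (1%:M + B *m A).
Proof.
have e1 : block_mx 1%:M (- A) B 1%:M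
    = block_mx 1%:M (- A) 0 1%:M *m block_mx (1%:M + A *m B) 0 B 1%:M.
  by rewrite mulmx_block !(mul1mx, mul0mx, mulmx1, mulmx0, add0r) mulNmx addrK.
have e2 : block_mx 1%:M (- A) B 1%:M
    = block_mx 1%:M 0 B 1%:M *m block_mx 1%:M (- A) 0 (1%:M + B *m A).
  rewrite mulmx_block !(mul1mx, mul0mx, mulmx1, mulmx0, addr0) mulmxN.
  by rewrite addrCA addNr addr0.
have := congr1 determinant e1; rewrite e2 !det_mulmx !det_ublock !det_lblock.
by rewrite !det1 !mul1r mulr1.
Qed.

(** Sylvester's identity reduces the determinant to the scalar [1 - 2 * dot a a]. *)
Lemma det_reflection a : dot a a = 1 -> \det (reflection a) = -1.
Proof.
move=> ha; rewrite /reflection -mulNmx det_add1_mulmx det_mx11 !mxE.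
rewrite (_ : \sum_j _ = - 2 * dot a a); first by rewrite ha eqxx /=; lra.
by rewrite dotE mulr_sumr; apply: eq_bigr => i _; rewrite !mxE; ring.
Qed.

(** A matrix with three rows and two columns has a nonzero left kernel. Unlike a normalized cross
    product, this covers parallel [u] and [v], as where the surface normal is along the axis. *)
Lemma ex_unit_orthogonal u v :
  exists e, [/\ dot e e = 1, dot u e = 0 & dot v e = 0].
Proof.
pose K := kermx (row_mx u v).
have K0 : K != 0.
  rewrite -mxrank_eq0 mxrank_ker subn_eq0 -ltnNge.
  exact: leq_ltn_trans (rank_leq_col _) _.
have [i Ki] : exists i, row i K != 0.
  apply/existsP; apply: contraR K0; rewrite negb_exists => /forallP h.
  by apply/eqP/row_matrixP => i; rewrite row0; apply/eqP/negbNE/h.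
pose w := (row i K)^T.
have w0 : w != 0 by rewrite -(inj_eq trmx_inj) trmxK trmx0.
have : w^T *m row_mx u v = 0.
  by rewrite trmxK; apply/sub_kermxP; exact: row_sub.
rewrite mul_mx_row -[0 in RHS]row_mx0 => /eq_row_mx [hu hv].
have nw : 0 < enorm w by rewrite sqrtr_gt0 dot_gt0.
exists ((enorm w)^-1 *: w); split; rewrite dotZr.
- rewrite dotC dotZr mulrA -invfM -expr2 sqr_sqrtr ?ltW ?dot_gt0 //.
  by rewrite mulVf // gt_eqF // dot_gt0.
- by rewrite dotC /dot hu mxE mulr0.
by rewrite dotC /dot hv mxE mulr0.
Qed.

Lemma linear_cV_mulmx (f : {linear E -> E}) :
  exists J : 'M[R]_3, forall u, f u = J *m u.
Proof.
exists (\matrix_(i, j) f (delta_mx j 0) i 0) => u.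
rewrite [in LHS](matrix_sum_delta u) linear_sum; apply/colP => i.
rewrite summxE mxE; apply: eq_bigr => j _.
by rewrite big_ord1 linearZ !mxE mulrC.
Qed.

End Algebra.

(** * Locality of derivatives and composition with linear maps *)

Section Calculus.
Variable R : realType.
Implicit Types V W : normedModType R.

(** The first-order expansion of [f] at [x] is also one of [g], and uniqueness of the differential
    identifies its linear part with that of [g]. *)
Lemma near_eq_differentiable V W (f g : V -> W) x :
  (\near x, f x = g x) -> differentiable f x -> differentiable g x.
Proof.
move=> fg df; have gx := nbhs_singleton fg.
have [dfc /eqaddoP dfe] := (diff_locallyP _ _).1 df.
have dge : g \o shift x = cst (g x) + 'd f x +o_ 0 id.
  apply/eqaddoP => e e0; have := dfe e e0.
  have fg0 : \forall h \near 0, f (h + x) = g (h + x).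
    by move: fg; rewrite (near_shift 0) /= subr0.
  by apply: filterS2 fg0 => h; rewrite /= !fctE /= gx => ->.
by apply/diff_locallyP; rewrite (diff_unique dfc dge).
Qed.

Lemma is_derive_comp V V' W (f : V -> V') (g : V' -> W) x v :
  differentiable f x -> differentiable g (f x) ->
  is_derive x v (g \o f) ('d g (f x) ('D_v f x)).
Proof.
move=> df dg; have dgf := differentiable_comp df dg.
apply: DeriveDef; first exact: diff_derivable.
by rewrite !deriveE // diff_comp.
Qed.

Lemma is_derive_linear V V' W (f : V -> V') (L : {linear V' -> W}) x v :
  continuous L -> differentiable f x ->
  is_derive x v (L \o f) (L ('D_v f x)).
Proof.
move=> cL df; have dL := linear_differentiable (f x) cL.
by have := is_derive_comp v df dL; rewrite diff_lin.
Qed.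

(** [g] is tied to [L \o f] on [A] only, for the sake of the induction: the derivatives of [g] are
    compared with the images under [L] of those of [f] at points of [A], where [f] is known to be
    differentiable. *)
Lemma Ck_linear_comp V W W' k (L : {linear W -> W'}) (f : V -> W)
    (g : V -> W') (A : set V) :
  continuous L -> open A -> (forall x, A x -> g x = L (f x)) ->
  Ck k f A -> Ck k g A.
Proof.
move=> cL oA; elim: k f g => [|k IH] f g fg /=.
  move=> cf x Ax; rewrite /prop_for /continuous_at fg //.
  have /near_eq_cvg H : \forall z \near x, (L \o f) z = g z.
    by near do rewrite fg //=; exact: open_nbhs_nbhs.
  apply: cvg_trans H _.
  by apply: continuous_comp; [exact: cf | exact: cL].
move=> [df Df]; have near_fg x : A x -> \forall z \near x, (L \o f) z = g z.
  by move=> Ax; near do rewrite fg //=; exact: open_nbhs_nbhs.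
split=> [x Ax|v].
  apply: near_eq_differentiable (near_fg _ Ax) _.
  by apply: differentiable_comp; [exact: df | exact: linear_differentiable].
apply: IH _ _ _ (Df v) => x Ax.
rewrite -(near_eq_derive _ (near_fg _ Ax)).
by have [] := is_derive_linear v cL (df x Ax).
Unshelve. all: by end_near. Qed.

Lemma Ck_comp_linear V V' W k (L : {linear V' -> V}) (f : V -> W) (A : set V) :
  continuous L -> Ck k f A -> Ck k (f \o L) (L @^-1` A).
Proof.
move=> cL; elim: k f => [|k IH] f /=.
  by move=> cf x Ax; apply: continuous_comp; [exact: cL | exact: cf].
move=> [df Df]; split=> [x Ax|v].
  by apply: differentiable_comp; [exact: linear_differentiable | exact: df].
(* An equality of functions on the whole space: by linearity of [L] the difference quotients
   themselves coincide. *)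
rewrite (_ : 'D_v (f \o L) = 'D_(L v) f \o L); first exact: IH _ (Df _).
apply/funext => x; rewrite /derive /=.
have Lshift h : L (h *: v + x) = h *: L v + L x by rewrite linearP.
by under eq_fun do rewrite Lshift.
Qed.

Lemma Ck_cst V W k (w : W) (A : set V) : Ck k (fun _ : V => w) A.
Proof.
elim: k w => [|k IH] w /=; first by move=> x _; exact: cst_continuous.
split=> [x _|v]; first exact: differentiable_cst.
by rewrite (_ : 'D_v _ = fun=> 0) //; apply/funext => x; exact: derive_cst.
Qed.

Lemma smooth_linear V W (L : {linear V -> W}) (A : set V) :
  continuous L -> smooth L A.
Proof.
move=> cL [|k] /=; first by move=> x _; exact: cL.
split=> [x _|v]; first exact: linear_differentiable.
rewrite (_ : 'D_v L = fun=> L v); first exact: Ck_cst.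
apply/funext => x; rewrite deriveE ?diff_lin //; exact: linear_differentiable.
Qed.

Lemma mulmx_continuous m p (M : 'M[R]_(m, p)) :
  continuous (mulmx M : 'cV[R]_p -> 'cV[R]_m).
Proof.
have -> : mulmx M = \sum_(j < p) (fun u : 'cV_p => u j 0 *: col j M).
  apply/funext => u; rewrite fct_sumE; apply/colP => i.
  by rewrite summxE mxE; apply: eq_bigr => j _; rewrite !mxE mulrC.
move=> u; apply/differentiable_continuous/differentiable_sum => j.
exact/differentiableZl/differentiable_coord.
Qed.

(** For a unit field along a curve, this makes the derivative orthogonal to the field. *)
Lemma is_derive_dot (f : R -> 'cV[R]_3) t : derivable f t 1 ->
  is_derive t 1 (fun s => dot (f s) (f s)) (2 * dot (f t) ('D_1 f t)).
Proof.
move=> df; have dfi i : is_derive t 1 (fun s => f s i 0) ('D_1 f t i 0).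
  by rewrite derive_mx // mxE; apply: derivableP; move/derivable_mxP: df.
rewrite (_ : (fun s => _) = \sum_(i < 3) (fun s => f s i 0 * f s i 0));
  last first.
  by apply/funext => s; rewrite dotE fct_sumE.
rewrite dotE mulr_sumr; apply: is_derive_sum => i.
apply: is_derive_eq (is_deriveM (dfi i) (dfi i)) _.
by rewrite /GRing.scale /=; ring.
Qed.

End Calculus.

(** * Orthogonal images of surfaces and the curvature tensor *)

Section Surfaces.
Variable R : realType.
Local Notation E := 'cV[R]_3.
Implicit Types (S : set E) (nu f : E -> E) (x : E) (Q H : 'M[R]_3).

Lemma is_derive_smooth_curve S a b (c : R -> E) t :
  smooth_curve_on S a b c -> a < t < b -> is_derive t 1 c (derive1 c t).
Proof.
move=> [/(_ 1%N) [dc _] _] tab; rewrite derive1E; apply/derivableP.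
by apply/derivable1_diffP/dc; rewrite /= in_itv.
Qed.

Lemma smooth_curve_mulmx S Q a b (c : R -> E) :
  smooth_curve_on S a b c ->
  smooth_curve_on [set Q *m x | x in S] a b (fun t => Q *m c t).
Proof.
move=> [cs cS]; split=> [k|t tab]; last by exists (c t) => //; exact: cS.
apply: (@Ck_linear_comp R _ _ _ k (mulmx Q) c) (cs k) => //.
exact: mulmx_continuous.
Qed.

Lemma is_derive_mulmx Q (c : R -> E) (t : R) (dc : E) : is_derive t 1 c dc ->
  is_derive t 1 (fun s => Q *m c s) (Q *m dc).
Proof.
move=> [/derivable1_diffP cd <-].
exact: (is_derive_linear (L := mulmx Q)) (@mulmx_continuous _ _ _ Q) cd.
Qed.

Section Orthogonal.
Variables (S : set E) (nu : E -> E) (Q : 'M[R]_3).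
Hypotheses (hS : oriented_surface S nu) (hQ : Q^T *m Q = 1%:M).
Local Notation QS := [set Q *m x | x in S].
(** [Q^T] leads back from the image to [S]. The sign is the one that the polar rotation dictates
    when [Q] is a reflection. *)
Local Notation nuQ := (fun x => - (Q *m nu (Q^T *m x))).

Let QK x : Q^T *m (Q *m x) = x.
Proof. by rewrite mulmxA hQ mul1mx. Qed.

(** Tangency and surface gradients are tested on curves, so conditions on the image reduce to
    conditions on [S] by pulling curves back. *)
Let curve_back a b (c : R -> E) : smooth_curve_on QS a b c ->
  smooth_curve_on S a b (fun t => Q^T *m c t).
Proof.
move=> /(smooth_curve_mulmx Q^T); suff -> : [set Q^T *m x | x in QS] = S by [].
rewrite image_comp (_ : _ \o _ = id) ?image_id //.
by apply/funext => x /=; rewrite QK.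
Qed.

Lemma smooth_surface_orthogonal : smooth_surface QS.
Proof.
have [sS _ _ _] := hS.
have cQ : continuous (mulmx Q : E -> E) by exact: mulmx_continuous.
have cQT : continuous (mulmx Q^T : E -> E) by exact: mulmx_continuous.
move=> _ [x Sx <-].
have [A [B [phi [psi [[oA Ax] oB sphi spsi [im can]]]]]] := sS x Sx.
exists (mulmx Q^T @^-1` A), B, (fun p => Q *m phi p), (psi \o mulmx Q^T).
split=> //.
- by split; [exact: open_comp | rewrite /= QK].
- by move=> k; apply: (Ck_linear_comp (L := mulmx Q)) (sphi k).
- by move=> k; exact: Ck_comp_linear.
split; last by move=> p Bp; rewrite /= QK can.
apply/seteqP; split=> [_ [p Bp <-]|z [/= Az [w Sw wz]]].
  have : (A `&` S) (phi p) by rewrite -im; exists p.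
  by move=> [Ap Sp]; split; [rewrite /= QK | exists (phi p)].
have : (phi @` B) w by rewrite im; split => //; rewrite -[w]QK wz.
by move=> [p Bp pw]; exists p => //; rewrite pw.
Qed.

Lemma oriented_surface_orthogonal : oriented_surface QS nuQ.
Proof.
have [_ nuk nu1 nuT] := hS; split.
- exact: smooth_surface_orthogonal.
- move=> k _ [x Sx <-]; have [A [F [oA Ax cF Fnu]]] := nuk k x Sx.
  have cQT : continuous (mulmx Q^T : E -> E) by exact: mulmx_continuous.
  have oA' : open (mulmx Q^T @^-1` A) by exact: open_comp.
  exists (mulmx Q^T @^-1` A), (fun z => (- Q) *m F (Q^T *m z)); split=> //.
  + by rewrite /= QK.
  + apply: (Ck_linear_comp (L := mulmx (- Q))) (Ck_comp_linear cQT cF) => //.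
    exact: mulmx_continuous.
  by move=> z /= Az [w Sw wz]; rewrite mulNmx Fnu // -wz QK.
- by move=> _ [x Sx <-]; rewrite dotNN dot_orthogonal // QK nu1.
move=> a b c cc t tab; have := nuT _ _ _ (curve_back cc) t tab.
have /(is_derive_mulmx Q^T) [_] := is_derive_smooth_curve cc tab.
rewrite -derive1E => ->; rewrite dot_mulmx trmxK => h.
by rewrite dotC dotNr dotC h oppr0.
Qed.

(** Along a curve [c] of the image, the new normal is [- Q] applied to [nu] along the curve
    [Q^T *m c t]; the chain rule then gives the tensor, with the sign of [nuQ]. *)
Lemma is_surface_gradient_orthogonal x H :
  is_surface_gradient S nu nu x H ->
  is_surface_gradient QS nuQ nuQ (Q *m x) (- (Q *m H *m Q^T)).
Proof.
move=> [Hn Hc]; split.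
  by rewrite QK mulNmx mulmxN opprK -!mulmxA QK Hn mulmx0.
move=> a b c cc t tab ctx; have cc' := curve_back cc.
have := Hc _ _ _ cc' t tab; rewrite ctx QK => /(_ erefl).
have /(is_derive_mulmx Q^T) [_] := is_derive_smooth_curve cc tab.
rewrite -derive1E => -> dn.
have := is_derive_mulmx (- Q) dn; rewrite !mulmxA !mulNmx.
by under eq_fun do rewrite mulNmx.
Qed.

End Orthogonal.

(** [nu] is regular only along [S], so the tensor comes from the differential of a local extension
    [F]. The second conclusion is built in by a left projector, in place of an appeal to the
    symmetry of the curvature tensor. *)
Lemma ex_curvature_tensor S nu x : oriented_surface S nu -> S x ->
  exists2 H, is_surface_gradient S nu nu x H & (nu x)^T *m H = 0.
Proof.
move=> [_ nuk nu1 nuT] Sx; have [A [F [oA Ax cF Fnu]]] := nuk 1%N x Sx.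
have dF : differentiable F x by case: cF => dF _; exact: dF.
have [J JE] := linear_cV_mulmx ('d F x).
have n1 := nu1 _ Sx.
(* The differential of nu maps tangent vectors to tangent vectors, nu having unit
   length, so the left projector does not change it along curves of S. *)
exists (proj (nu x) *m J *m proj (nu x)); last first.
  rewrite !mulmxA -(trmx_proj (nu x)) -trmx_mul proj_normal //.
  by rewrite trmx0 !mul0mx.
split; first by rewrite -mulmxA proj_normal // mulmx0.
move=> a b c cc t tab ctx.
have [/derivable1_diffP dc _] := is_derive_smooth_curve cc tab.
have itv_t : \forall s \near t, a < s < b.
  have : nbhs t `]a, b[%classic.
    by apply: open_nbhs_nbhs; split=> //=; exact: interval_open.
  by apply: filterS => s /=; rewrite in_itv.
(* Near [t] the curve stays in both [A] and [S], so [F] and [nu] have the same derivative along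
   it. *)
have FnuC : \forall s \near t, (F \o c) s = (nu \o c) s.
  have cA : \forall s \near t, A (c s).
    apply: (differentiable_continuous dc); rewrite ctx.
    exact: open_nbhs_nbhs.
  near=> s; apply: Fnu; first by near: s.
  by case: cc => _; apply; near: s.
have dnu : is_derive t 1 (nu \o c) (J *m derive1 c t).
  apply: near_eq_is_derive FnuC _; rewrite derive1E -JE -ctx.
  by apply: is_derive_comp; rewrite ?ctx.
suff -> : proj (nu x) *m J *m proj (nu x) *m derive1 c t = J *m derive1 c t.
  by [].
rewrite -!mulmxA [proj _ *m derive1 c t]proj_tangent; last first.
  by rewrite -ctx; exact: nuT cc t tab.
rewrite proj_tangent //.
have [dd dv] := dnu.
have d2 := is_derive_dot dd.
have d0 : is_derive t 1 (fun s => dot ((nu \o c) s) ((nu \o c) s)) 0.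
  apply: near_eq_is_derive (is_derive_cst (1 : R) t 1).
  by near=> s; rewrite /cst /= nu1 //; case: cc => _; apply; near: s.
have := @derive_val _ _ _ _ _ _ _ d2.
rewrite (@derive_val _ _ _ _ _ _ _ d0) dv /= ctx.
by move/esym/eqP; rewrite mulf_eq0 pnatr_eq0 /= => /eqP.
Unshelve. all: by end_near. Qed.

End Surfaces.

(** * The polar rotation as a product of two reflections *)

Section PolarRotation.
Variable R : realType.
Implicit Types (a n : 'cV[R]_3).

Lemma SO3_reflections a n : dot a a = 1 -> dot n n = 1 ->
  SO3 (reflection a *m reflection n).
Proof.
move=> ha hn; split; last by rewrite det_mulmx !det_reflection // mulrNN mulr1.
rewrite trmx_mul !trmx_reflection mulmxA -[X in X *m _]mulmxA.
by rewrite reflection_invol // mulmx1 reflection_invol.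
Qed.

(** [reflection n] is the identity on the tangent plane: inserting it keeps the gradient and turns
    the determinant of the orthogonal factor from -1 to 1. *)
Lemma polar_decomposition_reflection a n : dot a a = 1 -> dot n n = 1 ->
  polar_decomposition n (reflection a *m proj n)
    (reflection a *m reflection n) (proj n).
Proof.
move=> ha hn; split.
- by rewrite -mulmxA reflection_proj.
- exact: SO3_reflections.
- exact: trmx_proj.
- exact: proj_normal.
by move=> u un u0; rewrite proj_tangent ?dot_gt0 // dotC.
Qed.

(** A direction [e] common to both mirror planes is fixed by both reflections. For parallel [a] and
    [n] the product is the identity and any unit tangent vector serves as axis. *)
Lemma bending_reflections a n : dot a a = 1 -> dot n n = 1 ->
  bending_drilling n (reflection a *m reflection n)
    (reflection a *m reflection n) 1%:M.
Proof.
move=> ha hn; have [e [ee ae ne]] := ex_unit_orthogonal a n.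
split; first by rewrite mulmx1.
  by split; rewrite ?mul1mx //; split; rewrite ?trmx1 ?mul1mx ?det1.
exists e; split; first by rewrite dotC.
split=> //; first exact: SO3_reflections.
by rewrite -mulmxA !reflection_fix.
Qed.

End PolarRotation.

Theorem proposition8 (R : realType) (S : set 'cV[R]_3)
    (nu : 'cV[R]_3 -> 'cV[R]_3) (hS : oriented_surface S nu)
    (hrev : surface_of_revolution S) :
  exists (y : 'cV[R]_3 -> 'cV[R]_3) (Rot U : 'cV[R]_3 -> 'M[R]_3)
      (nus : 'cV[R]_3 -> 'cV[R]_3),
    [/\ deformation S nu y Rot U nus,
        isometric S nu y,
        pure_bending S nu Rot
      & eversion S nu y Rot nus].
Proof.
have [c0 [a [b [J [r [z [[ha _ _] _ _ _ _]]]]]]] := hrev.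
have [_ _ nu1 nuT] := hS.
have hQ : (reflection a)^T *m reflection a = 1%:M.
  by rewrite trmx_reflection reflection_invol.
(* The projector kills the normal and acts as the identity on velocities of curves, which are
   tangent. *)
have grad x : S x ->
    is_surface_gradient S nu (mulmx (reflection a)) x
      (reflection a *m proj (nu x)).
  move=> Sx; split; first by rewrite -mulmxA proj_normal ?nu1 // mulmx0.
  move=> c d g cg t tcd gt.
  rewrite -mulmxA proj_tangent; last by rewrite -gt; exact: nuT cg t tcd.
  exact/is_derive_mulmx/(is_derive_smooth_curve cg).
(* The mirror plane passes through the origin rather than through the point [c0] of the axis; this
   changes the deformation by a translation and makes it linear. *)
exists (mulmx (reflection a)), (fun x => reflection a *m reflection (nu x)),
  (fun x => proj (nu x)),
  (fun x => - (reflection a *m nu ((reflection a)^T *m x))).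
split.
- split.
  + move=> x Sx; exists setT, (mulmx (reflection a)); split=> //.
      exact: openT.
    exact/smooth_linear/mulmx_continuous.
  + move=> x Sx; exists (reflection a *m proj (nu x)); first exact: grad.
    by apply: polar_decomposition_reflection; rewrite ?nu1.
  + exact: oriented_surface_orthogonal.
  move=> x Sx; rewrite mulmxA hQ mul1mx -mulmxA reflection_normal ?nu1 //.
  by rewrite mulmxN.
- move=> x Sx; exists (reflection a *m proj (nu x)); first exact: grad.
  have n1 := nu1 _ Sx.
  exact/(isometric_polarP n1 (polar_decomposition_reflection ha n1)).
- by move=> x Sx; eexists; apply: bending_reflections; rewrite ?nu1.
move=> x Sx; have [H gH nH] := ex_curvature_tensor hS Sx.
(* [H] absorbs the reflection in the tangent plane on either side, so conjugating it by
   [reflection a] or by the polar rotation gives the same tensor. *)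
have nH0 : reflection (nu x) *m H = H.
  by rewrite mulmxBl mul1mx -mulmxA nH mulmx0 subr0.
have Hn0 : H *m reflection (nu x) = H.
  by rewrite mulmxBr mulmx1 mulmxA -scalemxAr (proj1 gH) scaler0 mul0mx subr0.
exists H, (- (reflection a *m H *m (reflection a)^T)); split=> //.
  exact: is_surface_gradient_orthogonal.
rewrite trmx_mul (trmx_reflection (nu x)) -!mulmxA.
by rewrite (mulmxA H) Hn0 (mulmxA (reflection (nu x)) H) nH0.
Qed.
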